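(* Let $\mathfrak{g}$ be a finite dimensional complex simple Lie algebra of rank $n$ with root system $\Delta$, simple roots $\alpha_1,\dots,\alpha_n$ and corresponding set of positive roots $\Delta^+$. Let $$\xi := \prod_{\alpha\in\Delta^+}\frac{1-e^{-\alpha}}{1-t\,e^{-\alpha}}\in \mathbb{Q}[t][[e^{-\alpha_1},\dots,e^{-\alpha_n}]].$$ Then for every positive root $\beta\in\Delta^+$, the coefficient of $e^{-\beta}$ in $\xi$ is $t^{\mathrm{ht}(\beta)}-t^{\mathrm{ht}(\beta)-1}$.
   Context: Let $Q$ be the root lattice of $\mathfrak{g}$ and $Q^+$ the set of $\mathbb{Z}^{\ge 0}$-linear combinations of the simple roots $\alpha_1,\dots,\alpha_n$. For $\alpha\in Q$, $e^{\alpha}$ denotes the formal exponential, with $e^0=1$ and $e^{\alpha+\beta}=e^{\alpha}e^{\beta}$. The ring $\mathcal{A}:=\mathbb{Q}[t][[e^{-\alpha_1},\dots,e^{-\alpha_n}]]$ is the ring of formal power series in the $n$ variables $e^{-\alpha_1},\dots,e^{-\alpha_n}$ with coefficients in the polynomial ring $\mathbb{Q}[t]$; a typical element is $\sum_{\beta\in Q^+}c_\beta(t)e^{-\beta}$ with $c_\beta(t)\in\mathbb{Q}[t]$, and $c_\beta(t)$ is called the coefficient of $e^{-\beta}$. In $\mathcal{A}$, the factor $\frac{1-e^{-\alpha}}{1-te^{-\alpha}}$ is expanded as a geometric series, i.e. it equals $1+(t-1)e^{-\alpha}+t(t-1)e^{-2\alpha}+t^2(t-1)e^{-3\alpha}+\cdots$.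 For $\beta=\sum_{i=1}^n b_i\alpha_i\in Q^+$, the height is $\mathrm{ht}(\beta):=\sum_{i=1}^n b_i$. *)

(* Defs.v *)
From HB Require Import structures.
From mathcomp Require Import all_boot all_order all_algebra.
From mathcomp Require Import boolp classical_sets fsbigop reals.
From mathcomp Require Import complex.

Set Implicit Arguments.
Unset Strict Implicit.
Unset Printing Implicit Defensive.

Import GRing.Theory.
Local Open Scope ring_scope.

HB.mixin Record Vector_isLie (K : fieldType) (g : Type) of Vector K g := {
  lie : g -> g -> g;
  lie_linearl : forall y, linear (fun x => lie x y);
  lie_linearr : forall x, linear (lie x);
  liexx : forall x, lie x x = 0;
  lie_jacobi : forall x y z,
    lie x (lie y z) + lie y (lie z x) + lie z (lie x y) = 0
}.

#[short(type="lieAlgType")]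
HB.structure Definition LieAlgebra (K : fieldType) :=
  { g of Vector K g & Vector_isLie K g }.

Section LieAlgebras.
Variables (K : fieldType) (g : lieAlgType K).
Implicit Types (x y h : g) (H I : {vspace g}).

Definition lie_ideal I := forall x y, y \in I -> lie x y \in I.

Definition lie_simple :=
  (exists x y, lie x y != 0) /\
  (forall I, lie_ideal I -> I = 0%VS \/ I = fullv).

Definition ad_diagonalizable h :=
  exists2 X : seq g, basis_of fullv X &
    forall x, x \in X -> exists c : K, lie h x = c *: x.

(* The usual notion for a complex semisimple Lie algebra: an abelian
   subalgebra, equal to its own centraliser (equivalently, maximal among
   abelian subalgebras), all of whose elements are ad-diagonalizable. *)
Definition cartan_subalgebra H :=
  [/\ {in H &, forall h h', lie h h' = 0},
      forall x, {in H, forall h, lie h x = 0} -> x \in H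
    & {in H, forall h, ad_diagonalizable h}].

Section Roots.
Variable H : {vspace g}.

Definition dual := 'Hom(subvs_of H, K^o).

Definition weight_vector (lam : dual) x :=
  forall h : subvs_of H, lie (vsval h) x = (lam h : K) *: x.

Definition is_root (lam : dual) :=
  lam != 0 /\ (exists2 x, x != 0 & weight_vector lam x).

Variables (n : nat) (alpha : 'I_n -> dual).

(* Q^+ is identified with N^n: b stands for sum_i b_i alpha_i. *)
Definition Qplus (b : {ffun 'I_n -> nat}) : dual := \sum_i alpha i *+ b i.

Definition simple_roots :=
  [/\ basis_of fullv (codom alpha), forall i, is_root (alpha i)
    & forall lam, is_root lam ->
        exists b, lam = Qplus b \/ lam = - Qplus b].

(* The positive roots, given by their coordinates in the simple roots. *)
Definition pos_roots : set {ffun 'I_n -> nat} := [set b | is_root (Qplus b)].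

End Roots.
End LieAlgebras.

Section Exponents.
Variable n : nat.
Implicit Types a b c d : {ffun 'I_n -> nat}.

Definition height b : nat := \sum_i b i.

Definition expo_le c b : bool := [forall i, c i <= b i]%N.

Definition expo_sub b c : {ffun 'I_n -> nat} := [ffun i => (b i - c i)%N].

Definition lower b : seq {ffun 'I_n -> nat} :=
  [seq c <- [seq [ffun i => val (c i)]
              | c : {ffun 'I_n -> 'I_(height b).+1}] | expo_le c b].

Lemma expo_leP c b : reflect (forall i, c i <= b i)%N (expo_le c b).
Proof. exact: forallP. Qed.

Lemma expo_le_trans c b d : expo_le b c -> expo_le c d -> expo_le b d.
Proof.
move=> /expo_leP bc /expo_leP cd; apply/expo_leP => i.
exact: leq_trans (bc i) (cd i).
Qed.

Lemma leq_height b i : (b i <= height b)%N.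
Proof. by rewrite /height (bigD1 i) //= leq_addr. Qed.

Lemma mem_lower b c : (c \in lower b) = expo_le c b.
Proof.
rewrite mem_filter; case: (boolP (expo_le c b)) => //= /expo_leP cb.
apply/mapP; exists [ffun i => inord (c i)]; first by rewrite mem_enum.
apply/ffunP => i; rewrite !ffunE /= inordK // ltnS.
exact: leq_trans (cb i) (leq_height b i).
Qed.

Lemma mem_lower_filter (p : pred _) b c :
  (c \in [seq d <- lower b | p d]) = p c && expo_le c b.
Proof. by rewrite mem_filter mem_lower. Qed.

Lemma lower_uniq b : uniq (lower b).
Proof.
rewrite filter_uniq // map_inj_uniq ?enum_uniq // => c d /ffunP cd.
by apply/ffunP => i; apply: val_inj; have := cd i; rewrite !ffunE.
Qed.

Lemma expo_subKC b c : expo_le c b -> expo_sub b (expo_sub b c) = c.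
Proof. by move=> /expo_leP cb; apply/ffunP => i; rewrite !ffunE subKn. Qed.

Lemma expo_sub_le b c : expo_le (expo_sub b c) b.
Proof. by apply/expo_leP => i; rewrite ffunE leq_subr. Qed.

Lemma expo_le0 b : expo_le 0 b.
Proof. by apply/expo_leP => i; rewrite ffunE. Qed.

Lemma expo_sub0 b : expo_sub b 0 = b.
Proof. by apply/ffunP => i; rewrite !ffunE subn0. Qed.

Lemma height_sub b c :
  expo_le c b -> (height b = height c + height (expo_sub b c))%N.
Proof.
move=> /expo_leP cb; rewrite /height -big_split /=; apply: eq_bigr => i _.
by rewrite ffunE subnKC.
Qed.

Lemma height_eq0 b : (height b == 0%N) = (b == 0).
Proof.
apply/eqP/eqP => [b0|->]; last first.
  by rewrite /height big1 // => i _; rewrite ffunE.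
apply/ffunP => i; rewrite ffunE; apply/eqP.
by rewrite -leqn0 -b0 leq_height.
Qed.

End Exponents.

(* coef f b is the coefficient of the monomial x^b = prod_i x_i^(b_i). *)
Record pseries (n : nat) (R : Type) :=
  PSeries { coef : {ffun 'I_n -> nat} -> R }.

Section PowerSeries.
Variables (n : nat) (R : comNzRingType).
Local Notation A := (pseries n R).
Implicit Types (f g h : A) (a b c d : {ffun 'I_n -> nat}).

HB.instance Definition _ := gen_eqMixin A.
HB.instance Definition _ := gen_choiceMixin A.

Lemma pseriesP f g : coef f =1 coef g -> f = g.
Proof. by case: f g => [f] [g] /= /funext ->. Qed.

Definition ps_add f g : A := PSeries (fun b => coef f b + coef g b).
Definition ps_opp f : A := PSeries (fun b => - coef f b).
Definition ps_mono (u : R) a : A :=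
  PSeries (fun b => if b == a then u else 0).
Definition ps_mul f g : A :=
  PSeries (fun b => \sum_(c <- lower b) coef f c * coef g (expo_sub b c)).

Let addA : associative ps_add.
Proof. by move=> f g h; apply: pseriesP => b; exact: addrA. Qed.
Let addC : commutative ps_add.
Proof. by move=> f g; apply: pseriesP => b; exact: addrC. Qed.
Let add0 : left_id (PSeries (fun=> 0)) ps_add.
Proof. by move=> f; apply: pseriesP => b; exact: add0r. Qed.
Let addN : left_inverse (PSeries (fun=> 0)) ps_opp ps_add.
Proof. by move=> f; apply: pseriesP => b; exact: addNr. Qed.

HB.instance Definition _ := GRing.isZmodule.Build A addA addC add0 addN.

Let mulC : commutative ps_mul.
Proof.
move=> f g; apply: pseriesP => b /=.
have p : perm_eq (lower b) [seq expo_sub b c | c <- lower b].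
  apply: uniq_perm; first exact: lower_uniq.
    rewrite map_inj_in_uniq ?lower_uniq // => c d.
    rewrite !mem_lower => cb db e.
    by rewrite -(expo_subKC cb) e expo_subKC.
  move=> c; rewrite mem_lower; apply/idP/mapP => [cb|[d _ ->]].
    by exists (expo_sub b c); rewrite ?mem_lower ?expo_sub_le ?expo_subKC.
  exact: expo_sub_le.
rewrite (perm_big _ p) big_map big_seq [RHS]big_seq; apply: eq_bigr => c.
by rewrite mem_lower => cb; rewrite expo_subKC // mulrC.
Qed.

Let mulA : associative ps_mul.
Proof.
move=> f g h; apply: pseriesP => b /=.
transitivity (\sum_(c <- lower b) \sum_(d <- lower b | expo_le d c)
    coef f d * coef g (expo_sub c d) * coef h (expo_sub b c)); last first.
  apply: eq_big_seq => c; rewrite mem_lower => cb.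
  have p : perm_eq (lower c) [seq d <- lower b | expo_le d c].
    apply: uniq_perm; first exact: lower_uniq.
      by apply: filter_uniq; exact: lower_uniq.
    move=> d; rewrite mem_lower mem_lower_filter.
    by case: (boolP (expo_le d c)) => //= dc; rewrite (expo_le_trans dc cb).
  by rewrite (perm_big _ p) big_filter mulr_suml.
rewrite /= (exchange_big_dep xpredT) //=; apply: eq_big_seq => d.
rewrite mem_lower => db; rewrite mulr_sumr.
have p : perm_eq (lower (expo_sub b d))
    [seq expo_sub c d | c <- [seq c <- lower b | expo_le d c]].
  apply: uniq_perm; first exact: lower_uniq.
    rewrite map_inj_in_uniq; first by apply: filter_uniq; exact: lower_uniq.
    move=> c c'.
    rewrite !mem_lower_filter => /andP[/expo_leP dc _] /andP[/expo_leP dc' _].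
    move=> /ffunP e; apply/ffunP => i; have := e i; rewrite !ffunE => {}e.
    by rewrite -(subnK (dc i)) e subnK.
  move=> e; rewrite mem_lower; apply/idP/mapP => [eb|[c]].
    exists (e + d).
      rewrite mem_lower_filter; apply/andP; split; apply/expo_leP => i.
        by rewrite ffunE leq_addl.
      move/expo_leP: eb => /(_ i); move/expo_leP: db => /(_ i).
      rewrite !ffunE => db eb; rewrite -(subnK db) -[(e i + d i)%R]/(e i + d i)%N.
      by rewrite leq_add2r.
    by apply/ffunP => i; rewrite !ffunE addnK.
  rewrite mem_lower_filter => /andP[_ /expo_leP cb] ->.
  by apply/expo_leP => i; rewrite !ffunE leq_sub2r.
rewrite (perm_big _ p) big_map big_filter; apply: eq_bigr => c /expo_leP dc.
rewrite mulrA; congr (_ * coef h _).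
by apply/ffunP => i; rewrite !ffunE -subnDA subnKC.
Qed.

Let mul1 : left_id (ps_mono 1 0) ps_mul.
Proof.
move=> f; apply: pseriesP => b /=.
rewrite (bigD1_seq 0) ?mem_lower ?expo_le0 ?lower_uniq //= eqxx mul1r.
by rewrite expo_sub0 big1 ?addr0 // => c /negPf ->; rewrite mul0r.
Qed.

Let mulDl : left_distributive ps_mul +%R.
Proof.
move=> f g h; apply: pseriesP => b /=.
by rewrite -big_split /=; apply: eq_bigr => c _; rewrite mulrDl.
Qed.

Let one_neq0 : ps_mono 1 0 != 0.
Proof.
apply/eqP => /(congr1 (fun f : A => coef f 0)) /=.
by rewrite eqxx => /eqP; rewrite oner_eq0.
Qed.

HB.instance Definition _ :=
  GRing.Zmodule_isComNzRing.Build A mulA mulC mul1 mulDl one_neq0.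

(* The geometric series 1 + f + f^2 + ..., for f without constant term: then
   f^k has no coefficient of height < k, so that the sum below is the full
   coefficient of exponent b (see ps_geomP). *)
Definition ps_geom f : A :=
  PSeries (fun b => \sum_(k < (height b).+1) coef (f ^+ k) b).

Lemma coef_exp_eq0 f b k :
  coef f 0 = 0 -> (height b < k)%N -> coef (f ^+ k) b = 0.
Proof.
move=> f0; elim: k b => // k IHk b bk; rewrite exprS.
rewrite [LHS]/(coef (ps_mul _ _) b) /= big_seq big1 // => c.
rewrite mem_lower => cb; have [->|c0] := eqVneq c 0; first by rewrite f0 mul0r.
rewrite [X in _ * X]IHk ?mulr0 //; apply: leq_trans (_ : height b <= k)%N => //.
by rewrite (height_sub cb) -[X in (X < _)%N]add0n ltn_add2r lt0n height_eq0.
Qed.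

Lemma ps_geomP f : coef f 0 = 0 -> (1 - f) * ps_geom f = 1.
Proof.
move=> f0; apply: pseriesP => b.
pose s : A := \sum_(k < (height b).+1) f ^+ k.
have coefS N (F : 'I_N -> A) c :
    coef (\sum_(k < N) F k) c = \sum_(k < N) coef (F k) c.
  by elim/big_rec2: _ => //= k x y _ <-.
transitivity (coef ((1 - f) * s) b).
  rewrite [LHS]/(coef (ps_mul _ _) b) [RHS]/(coef (ps_mul _ _) b) /=.
  apply: eq_big_seq => c; rewrite mem_lower => cb; congr (_ * _).
  rewrite coefS; set d := expo_sub b c.
  have db : (height d <= height b)%N by rewrite (height_sub cb) leq_addl.
  rewrite -(big_mkord xpredT (fun k => coef (f ^+ k) d)).
  rewrite -(big_mkord xpredT (fun k => coef (f ^+ k) d)).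
  have tail0 : \sum_((height d).+1 <= k < (height b).+1) coef (f ^+ k) d = 0.
    by rewrite big_nat big1 // => k /andP[dk _]; exact: coef_exp_eq0.
  by rewrite [RHS](@big_cat_nat _ _ _ (height d).+1) //= tail0 addr0.
rewrite -[1 - f]opprB mulNr -subrX1 opprB.
rewrite -[LHS]/(coef (1 : A) b - coef (f ^+ (height b).+1) b).
by rewrite coef_exp_eq0 // subr0.
Qed.

End PowerSeries.

(* (1 - e^(-a)) / (1 - t e^(-a)), with x_i = e^(-alpha_i), so that e^(-a) is
   the monomial of exponent a, and t = 'X in {poly rat}. *)
Definition xi_factor n (a : {ffun 'I_n -> nat}) : pseries n {poly rat} :=
  (1 - ps_mono 1 a) * ps_geom (ps_mono 'X a).

Lemma xi_factorP n (a : {ffun 'I_n -> nat}) :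
  a != 0 -> xi_factor a * (1 - ps_mono 'X a) = 1 - ps_mono 1 a.
Proof.
move=> a0; rewrite /xi_factor -mulrA [X in _ * X]mulrC ps_geomP ?mulr1 //=.
by rewrite eq_sym (negPf a0).
Qed.

(* The set of positive roots is finite, so this is the full product. *)
Definition xi (K : fieldType) (g : lieAlgType K) (H : {vspace g}) n
    (alpha : 'I_n -> dual H) : pseries n {poly rat} :=
  \big[*%R/1]_(a \in pos_roots alpha) xi_factor a.

(* Main.v *)
Require Import Defs.
From HB Require Import structures.
From mathcomp Require Import all_boot all_order all_algebra.
From mathcomp Require Import boolp classical_sets cardinality fsbigop reals.
From mathcomp Require Import complex.
From mathcomp Require Import zify ring.

Set Implicit Arguments.
Unset Strict Implicit.
Unset Printing Implicit Defensive.
Import Order.TTheory GRing.Theory Num.Theory.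
Import VectorInternalTheory.
Local Open Scope ring_scope.

(** Write x_i for the formal exponential of minus the i-th simple root, s_i for
the simple reflection, and [m] for the value of the root [b] on the i-th simple
coroot.

Let xi' be xi without the factor of the simple root alpha_i, so that
(1 - t x_i) xi = (1 - x_i) xi'.  As s_i permutes the positive roots other than
alpha_i, the coefficients of xi' are invariant under s_i ([reflected_prod]).
Given a positive root [b] other than alpha_i, choose [i] with [m > 0].  The
exponents b - j alpha_i, for [0 <= j <= m], are all positive roots, the last one
being s_i b.  By induction on the height, the coefficients of xi at
b - alpha_i, ..., b - m alpha_i form a geometric progression of ratio t, so the
relation between xi and xi' makes xi' constant on this range.  Its common value
there is its value at b, because s_i exchanges b with b - m alpha_i.  Hence the
same relation at b says that the coefficient of xi at b is t times that at
b - alpha_i ([coef_prod_xi_factor]).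

What this uses about roots -- stability under simple reflections, unbroken
strings, and a simple coroot positive on any given positive root -- is derived
from the definitions.  Diagonalizing a Cartan subalgebra simultaneously gives a
basis of weight vectors ([weight_basis_exists]).  If [e] and [f] have opposite
nonzero weights, acting with [f] on a vector annihilated by [e] computes all the
weights on h = [e, f] ([root_string]); in particular they are all rational
multiples of the value of the weight of [e], which therefore cannot vanish when
h is nonzero, since h would be central.  So a nonzero bracket yields an
sl2-triple, whose h has integral weights and thus a positive Killing square
([sl2_killing]).  Since some bracket of opposite weight vectors is nonzero
([opposite_bracket_exists]), the Killing form is not identically zero, hence
nondegenerate by simplicity ([killing_nondegenerate]); this in turn gives an
sl2-triple for every root ([sl2_exists]).  Finally, for coroots h and h' of
roots a and a', the symmetry of the Killing form makes a h' and a' h agree in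
sign ([sl2_pairing_sign]); as a positive root is positive on its own coroot,
some simple root is positive on that coroot too, and then the positive root is
positive on the coroot of that simple root. *)

(** * Coefficients of power series *)

Section SeriesCoefficients.
Variables (n : nat) (R : comNzRingType).
Local Notation A := (pseries n R).
Implicit Types (f g : A) (b c : {ffun 'I_n -> nat}).

Lemma coefB f g b : coef (f - g) b = coef f b - coef g b.
Proof. by []. Qed.

Lemma coefM f g b :
  coef (f * g) b = \sum_(c <- lower b) coef f c * coef g (expo_sub b c).
Proof. by []. Qed.

Lemma coef1 b : coef (1 : A) b = if b == 0 then 1 else 0.
Proof. by []. Qed.

Lemma coefM_mono f u a b : 
  coef (f * ps_mono u a) b =
    if expo_le a b then coef f (expo_sub b a) * u else 0.
Proof.
rewrite mulrC coefM /=; case: ifP => ab.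
  rewrite (bigD1_seq a) ?mem_lower ?lower_uniq //= eqxx big1 ?addr0 1?mulrC //.
  by move=> c /negPf ->; rewrite mul0r.
rewrite big_seq big1 // => c; rewrite mem_lower => cb.
by case: eqP cb => [->|_ _]; rewrite ?mul0r // ab.
Qed.

Lemma coefM0 f g : coef (f * g) 0 = coef f 0 * coef g 0.
Proof.
rewrite coefM (bigD1_seq 0) ?mem_lower ?expo_le0 ?lower_uniq //= expo_sub0.
rewrite big_seq_cond big1 ?addr0 // => c.
rewrite mem_lower => /andP[/expo_leP c0].
by case/eqP; apply/ffunP => i; have := c0 i; rewrite ffunE leqn0 => /eqP.
Qed.

(** Any truncation order that is at least the height gives the coefficient, so
two exponents of different heights can be compared at a common order. *)
Lemma coef_geom f b N : coef f 0 = 0 -> (height b <= N)%N ->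
  coef (ps_geom f) b = \sum_(k < N.+1) coef (f ^+ k) b.
Proof.
move=> f0 bN /=; rewrite -!(big_mkord xpredT (fun k => coef (f ^+ k) b)).
rewrite [RHS](@big_cat_nat _ _ _ (height b).+1) //=.
rewrite [X in _ + X]big_nat [X in _ + X]big1 ?addr0 // => k /andP[bk _].
exact: coef_exp_eq0.
Qed.

End SeriesCoefficients.

Definition unit_expo n (i : 'I_n) : {ffun 'I_n -> nat} :=
  [ffun j => (j == i : nat)].

Lemma expo_le_unit n (i : 'I_n) (b : {ffun 'I_n -> nat}) :
  expo_le (unit_expo i) b = (0 < b i)%N.
Proof.
apply/expo_leP/idP => [/(_ i)|bi j]; first by rewrite ffunE eqxx.
by rewrite ffunE; case: eqP => // ->.
Qed.

Lemma height_unit n (i : 'I_n) : height (unit_expo i) = 1%N.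
Proof.
rewrite /height (bigD1 i) //= ffunE eqxx big1 // => j /negPf ji.
by rewrite ffunE ji.
Qed.

(** * Reflecting exponents in a simple root *)

Section Reflection.
Variables (n : nat) (i : 'I_n) (c : 'I_n -> int).
Hypothesis ci : c i = 2.
Implicit Types a b d : {ffun 'I_n -> nat}.

(** With [c j] the value of the j-th simple root on the i-th simple coroot, this
is the value of the exponent [b] on that coroot. *)
Definition pairing b : int := \sum_j c j *+ b j.

(** Exponents have natural coordinates: the reflection b - (pairing b) alpha_i
is an exponent exactly under this condition. *)
Definition reflectable b : bool := pairing b <= (b i)%:Z.

Definition reflect_expo b : {ffun 'I_n -> nat} :=
  [ffun j => if j == i then `|(b i)%:Z - pairing b|%N else b j].

Local Notation s := reflect_expo.

Lemma pairingD a b : pairing (a + b) = pairing a + pairing b.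
Proof.
by rewrite -big_split /=; apply: eq_bigr => j _; rewrite ffunE mulrnDr.
Qed.

Lemma pairing0 : pairing 0 = 0.
Proof. by apply: big1 => j _; rewrite ffunE. Qed.

Lemma unit_expo_not_reflectable : ~~ reflectable (unit_expo i).
Proof.
rewrite /reflectable /pairing (bigD1 i) //= ffunE eqxx ci big1 //.
by move=> j /negPf ji; rewrite ffunE ji.
Qed.

Lemma pairing_reflect b : reflectable b -> pairing (s b) = - pairing b.
Proof.
move=> ok; rewrite /pairing (bigD1 i) //= ffunE eqxx ci.
rewrite (eq_bigr (fun j => c j *+ b j)); last first.
  by move=> j /negPf ji; rewrite ffunE ji.
have := ok; rewrite /reflectable /pairing (bigD1 i) //= ci.
have two m : 2 *+ m = m%:Z * 2 by rewrite -[LHS]mulr_natl natz.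
rewrite !two.
move: (\sum_(j | _) _) (b i) => p m; clear; lia.
Qed.

Lemma reflectable_reflect b : reflectable b -> reflectable (s b).
Proof.
move=> ok; rewrite /reflectable pairing_reflect // ffunE eqxx.
move: ok; rewrite /reflectable; lia.
Qed.

Lemma reflect_expoK b : reflectable b -> s (s b) = b.
Proof.
move=> ok; apply/ffunP => j; rewrite ffunE pairing_reflect // !ffunE eqxx.
case: eqP => [->|//]; move: ok; rewrite /reflectable.
move: (pairing b) (b i) => p m; lia.
Qed.

Lemma reflectable0 : reflectable 0.
Proof. by rewrite /reflectable pairing0 ffunE. Qed.

Lemma reflect_expo0 : s 0 = 0.
Proof.
by apply/ffunP => j; rewrite !ffunE pairing0 subr0; case: eqP.
Qed.

Lemma reflectableD a b : reflectable a -> reflectable b -> reflectable (a + b).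
Proof.
by rewrite /reflectable pairingD ffunE => ha hb; rewrite PoszD lerD.
Qed.

Lemma reflect_expoD a b :
  reflectable a -> reflectable b -> s (a + b) = s a + s b.
Proof.
move=> oka okb; apply/ffunP => j; rewrite !ffunE pairingD.
case: eqP => // _; move: oka okb; rewrite /reflectable.
rewrite -[a i + b i]/(a i + b i)%N -[RHS]/(addn _ _); lia.
Qed.

Lemma expo_subKD b d : expo_le d b -> d + expo_sub b d = b.
Proof.
move=> /expo_leP db; apply/ffunP => j; rewrite !ffunE.
by rewrite -[LHS]/(d j + (b j - d j))%N subnKC.
Qed.

Lemma expo_subDl a b : expo_sub (a + b) a = b.
Proof.
by apply/ffunP => j; rewrite !ffunE -[a j + b j]/(a j + b j)%N addKn.
Qed.

Lemma expo_leDl a b : expo_le a (a + b).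
Proof.
by apply/expo_leP => j; rewrite ffunE -[a j + b j]/(a j + b j)%N leq_addr.
Qed.

Section Reflected.
Variable R : comNzRingType.
Local Notation A := (pseries n R).
Implicit Types f g : A.

(** Extend coefficients by zero to all integral exponents: then this says that
[g] is the image of [f] under the simple reflection.  The reflection does not
act on all power series, hence a relation rather than an operation. *)
Definition reflected f g := forall b,
  if reflectable b then coef g (s b) = coef f b
  else coef f b = 0 /\ coef g b = 0.

Lemma reflectedB f g f' g' :
  reflected f g -> reflected f' g' -> reflected (f - f') (g - g').
Proof.
move=> fg fg' b; have := fg b; have := fg' b; rewrite !coefB.
by case: ifP => _ => [-> ->|[-> ->] [-> ->]]; rewrite ?subrr.
Qed.

Lemma reflected_mono u a : reflectable a ->
  reflected (ps_mono u a) (ps_mono u (s a)).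
Proof.
move=> oka b /=; case: ifPn => okb.
  by congr (if _ then _ else _); apply/eqP/eqP => [/(congr1 s)|->//];
    rewrite !reflect_expoK.
split; case: eqP => // ba; first by rewrite ba oka in okb.
by rewrite ba reflectable_reflect in okb.
Qed.

Lemma reflected1 : reflected 1 1.
Proof. by have := reflected_mono 1 reflectable0; rewrite reflect_expo0. Qed.

(** The reflection is additive, so it matches the decompositions of [b] into two
exponents with those of its reflection; only decompositions into reflectable
exponents contribute to the coefficients. *)
Lemma reflectedM f g f' g' :
  reflected f g -> reflected f' g' -> reflected (f * f') (g * g').
Proof.
move=> fg fg' b; rewrite !coefM.
pose ok d e := reflectable e && reflectable (expo_sub d e).
have restrict (F F' : A) d :
    (forall e, ~~ reflectable e -> coef F e = 0) ->
    (forall e, ~~ reflectable e -> coef F' e = 0) ->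
  \sum_(e <- lower d) coef F e * coef F' (expo_sub d e) =
  \sum_(e <- lower d | ok d e) coef F e * coef F' (expo_sub d e).
  move=> F0 F'0; rewrite [RHS]big_mkcond; apply: eq_bigr => e _.
  case: ifPn => //; rewrite negb_and => /orP[/F0|/F'0] ->.
    by rewrite mul0r.
  by rewrite mulr0.
rewrite !restrict; do ?by move=> e /negPf no;
  have := fg e; have := fg' e; rewrite no => -[? ?] [].
case: ifPn => okb; last first.
  suff no e : e \in lower b -> ~~ ok b e.
    by split; rewrite big_seq_cond big1 // => e /andP[/no/negPf ->].
  rewrite mem_lower => eb; apply: contra okb => /andP[oke okbe].
  by rewrite -(expo_subKD eb) reflectableD.
have okP d e : reflectable d -> e \in [seq e <- lower d | ok d e] ->
    exists e', [/\ reflectable e, reflectable e' & d = e + e'].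
  move=> okd; rewrite mem_lower_filter => /andP[/andP[oke okde] ed].
  by exists (expo_sub d e); split; rewrite ?expo_subKD.
have p : perm_eq [seq e <- lower (s b) | ok (s b) e]
    [seq s e | e <- [seq e <- lower b | ok b e]].
  apply: uniq_perm; first by apply: filter_uniq; exact: lower_uniq.
    rewrite map_inj_in_uniq; first by apply: filter_uniq; exact: lower_uniq.
    move=> e e' /(okP _ _ okb)[? [oke _ _]] /(okP _ _ okb)[? [oke' _ _]].
    by move/(congr1 s); rewrite !reflect_expoK.
  have inS d e : reflectable d -> e \in [seq e <- lower d | ok d e] ->
      s e \in [seq e <- lower (s d) | ok (s d) e].
    move=> okd /(okP _ _ okd)[e' [oke oke' ->]].
    rewrite mem_lower_filter /ok reflect_expoD // expo_leDl expo_subDl.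
    by rewrite !reflectable_reflect.
  move=> e; apply/idP/mapP => [|[d de ->]]; last exact: inS.
  move=> es; have okd := reflectable_reflect okb.
  have [? [oke _ _]] := okP _ _ okd es.
  by exists (s e); [have := inS _ _ okd es|]; rewrite reflect_expoK.
rewrite -big_filter (perm_big _ p) big_map -[RHS]big_filter.
rewrite big_seq [RHS]big_seq.
apply: eq_bigr => e /(okP _ _ okb)[e' [oke oke' ->]].
rewrite reflect_expoD // !expo_subDl.
by have := fg e; have := fg' e'; rewrite oke oke' => -> ->.
Qed.

Lemma reflectedX f g k : reflected f g -> reflected (f ^+ k) (g ^+ k).
Proof.
move=> fg; elim: k => [|k IH]; first exact: reflected1.
by rewrite !exprS; exact: reflectedM.
Qed.

Lemma reflected_geom f g : coef f 0 = 0 -> coef g 0 = 0 ->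
  reflected f g -> reflected (ps_geom f) (ps_geom g).
Proof.
move=> f0 g0 fg b; case: ifPn => okb; last first.
  split; apply: big1 => k _; have := reflectedX k fg b;
  by rewrite (negPf okb) => -[].
set N := maxn (height b) (height (s b)).
rewrite (coef_geom f0 (leq_maxl _ (height (s b)))).
rewrite (coef_geom g0 (leq_maxr (height b) _)).
by apply: eq_bigr => k _; have := reflectedX k fg b; rewrite okb.
Qed.

End Reflected.

Lemma reflect_expo_eq0 b : reflectable b -> (s b == 0) = (b == 0).
Proof.
move=> okb; apply/eqP/eqP => [/(congr1 s)|->]; last exact: reflect_expo0.
by rewrite reflect_expoK // reflect_expo0.
Qed.

Lemma reflected_xi_factor a : a != 0 -> reflectable a ->
  reflected (xi_factor a) (xi_factor (s a)).
Proof.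
move=> a0 oka; apply: reflectedM.
  by apply: reflectedB; [exact: reflected1|exact: reflected_mono].
apply: reflected_geom; last exact: reflected_mono.
  by rewrite /= eq_sym (negPf a0).
by rewrite /= eq_sym reflect_expo_eq0 // (negPf a0).
Qed.

(** The reflection maps the factor of [a] to the factor of its reflection, so it
only permutes the factors. *)
Lemma reflected_prod (P : seq {ffun 'I_n -> nat}) : uniq P ->
  {in P, forall a, [/\ a != 0, reflectable a & s a \in P]} ->
  reflected (\prod_(a <- P) xi_factor a) (\prod_(a <- P) xi_factor a).
Proof.
move=> uP sP; have p : perm_eq P (map s P).
  apply: uniq_perm => //.
    rewrite map_inj_in_uniq // => a b /sP[_ oka _] /sP[_ okb _].
    by move=> /(congr1 s); rewrite !reflect_expoK.
  move=> a; apply/idP/mapP => [aP|[b /sP[_ _ sb] ->] //].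
  by have [_ oka saP] := sP a aP; exists (s a); rewrite ?reflect_expoK.
rewrite [X in reflected _ X](perm_big _ p) big_map.
rewrite [X in reflected X _]big_seq [X in reflected _ X]big_seq.
apply: (big_rec2 (fun f g => reflected f g)); first exact: reflected1.
move=> a f g /sP[a0 oka _] fg; apply: reflectedM => //.
exact: reflected_xi_factor.
Qed.

End Reflection.

(** * The coefficient at a positive root *)

Lemma coef0_xi_factor n (a : {ffun 'I_n -> nat}) :
  a != 0 -> coef (xi_factor a) 0 = 1.
Proof.
move=> a0; have := coefM0 (xi_factor a) (1 - ps_mono 'X a).
rewrite xi_factorP // !coefB !coef1 /= !(eq_sym 0 a) (negPf a0) eqxx.
by rewrite !subr0 mulr1 => <-.
Qed.

Lemma coef0_prod_xi_factor n (P : seq {ffun 'I_n -> nat}) :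
  {in P, forall a, a != 0} -> coef (\prod_(a <- P) xi_factor a) 0 = 1.
Proof.
move=> P0; rewrite big_seq; apply: (big_rec (fun f => coef f 0 = 1)) => //.
  by rewrite coef1 eqxx.
by move=> a f aP f1; rewrite coefM0 f1 mulr1 coef0_xi_factor // P0.
Qed.

(** Here [P] stands for the set of positive roots, and [C i j] for the value of
the j-th simple root on the i-th simple coroot. *)
Section RootCombinatorics.
Variables (n : nat) (C : 'I_n -> 'I_n -> int) (P : seq {ffun 'I_n -> nat}).
Hypotheses (C2 : forall i, C i i = 2) (uP : uniq P).
Hypothesis P_unit : forall i, unit_expo i \in P.
Hypothesis P_neq0 : {in P, forall a, a != 0}.
Hypothesis P_reflect : forall i, {in P, forall a, a != unit_expo i ->
  reflectable i (C i) a /\ reflect_expo i (C i) a \in P}.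
Hypothesis P_string : forall i, {in P, forall a, a != unit_expo i ->
  forall j : nat, j%:Z <= pairing (C i) a ->
    (j <= a i)%N /\ expo_sub a [ffun k => (j * (k == i))%N] \in P}.
Hypothesis P_pos : {in P, forall a, exists i, 0 < pairing (C i) a}.

Local Notation xi := (\prod_(a <- P) xi_factor a).
Local Notation xi' i := (\prod_(a <- rem (unit_expo i) P) xi_factor a).

Lemma reflected_xi' i : reflected i (C i) (xi' i) (xi' i).
Proof.
apply: reflected_prod => //; first exact: rem_uniq.
have okE a : a != unit_expo i -> a \in P ->
    reflectable i (C i) a /\ reflect_expo i (C i) a \in P.
  by move=> ai aP; exact: P_reflect.
move=> a; rewrite mem_rem_uniq // !inE => /andP[ai aP].
have [oka sP] := okE _ ai aP; split=> //; first exact: P_neq0.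
rewrite mem_rem_uniq // !inE sP andbT.
apply: contraTneq (reflectable_reflect (C2 i) oka) => ->.
exact: unit_expo_not_reflectable.
Qed.

(** Compare coefficients in (1 - t x_i) xi = (1 - x_i) xi'. *)
Lemma xi_rec i (b : {ffun 'I_n -> nat}) : (0 < b i)%N ->
  let b' := expo_sub b (unit_expo i) in
  coef xi b - 'X * coef xi b' = coef (xi' i) b - coef (xi' i) b'.
Proof.
move=> bi /=; have ui : unit_expo i != 0 by exact: P_neq0 (P_unit i).
have : xi * (1 - ps_mono 'X (unit_expo i)) =
    xi' i * (1 - ps_mono 1 (unit_expo i)).
  by rewrite (big_rem _ (P_unit i)) /= mulrAC xi_factorP // mulrC.
move/(congr1 (fun f => coef f b)).
rewrite !mulrBr !mulr1 !coefB !coefM_mono expo_le_unit bi mulr1.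
by rewrite [_ * 'X]mulrC.
Qed.

(** Induction on the height along the alpha_i-string below [b], where the i-th
simple coroot is positive on [b]: on that string xi' is constant and the
coefficients of xi grow by a factor t at each step. *)
Theorem coef_prod_xi_factor : {in P, forall b,
  coef xi b = 'X^(height b) - 'X^(height b - 1)}.
Proof.
move=> b; move: {2}(height b) (leqnn (height b)) => N.
elim: N b => [|N IH] b bN bP.
  by have := P_neq0 bP; rewrite -height_eq0 -leqn0 bN.
have [i posm] := P_pos bP.
have refl0 := reflected_xi' i.
(* A simple root is not reflectable, so xi' has coefficient 0 there, and the
   only input is the constant term 1 of both series. *)
have [->|bi] := eqVneq b (unit_expo i).
  have := @xi_rec i (unit_expo i); rewrite ffunE eqxx => /(_ isT) /=.
  have -> : expo_sub (unit_expo i) (unit_expo i) = 0.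
    by apply/ffunP => j; rewrite !ffunE subnn.
  have P'0 : {in rem (unit_expo i) P, forall a, a != 0}.
    by move=> a /mem_rem; exact: P_neq0.
  rewrite (coef0_prod_xi_factor P_neq0) (coef0_prod_xi_factor P'0).
  have := refl0 (unit_expo i).
  rewrite (negPf (unit_expo_not_reflectable (C2 i))) => -[_ ->].
  rewrite height_unit mulr1 => /(canRL (subrK _)) ->.
  by rewrite expr1 subnn expr0 sub0r addrC.
pose str j := expo_sub b [ffun k => (j * (k == i))%N].
have str0 : str 0%N = b by apply/ffunP => k; rewrite !ffunE mul0n subn0.
have strP j : j%:Z <= pairing (C i) b -> (j <= b i)%N /\ str j \in P.
  exact: P_string.
have strS j : str j.+1 = expo_sub (str j) (unit_expo i).
  by apply/ffunP => k; rewrite !ffunE; case: eqP => _; lia.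
have [m mE] : exists m, pairing (C i) b = m.+1%:Z.
  by exists `|pairing (C i) b|.-1%N; lia.
have stri j : (str j i = b i - j)%N by rewrite !ffunE eqxx muln1.
have hstr j : (j <= b i)%N -> (height (str j) = height b - j)%N.
  move=> jb; rewrite (@height_sub _ b [ffun k => (j * (k == i))%N]).
    suff -> : height [ffun k => (j * (k == i))%N] = j by rewrite addKn.
    rewrite /height (bigD1 i) //= ffunE eqxx muln1.
    rewrite big1 ?addn0 // => k /negPf ki.
    by rewrite ffunE ki muln0.
  apply/expo_leP => k; rewrite ffunE.
  by case: eqP => [->|]; rewrite ?muln1 ?muln0.
have bh : (b i <= height b)%N by exact: leq_height.
have [mb smP] := strP m.+1 ltac:(by rewrite mE).
have coef_str j : (0 < j <= m.+1)%N ->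
    coef xi (str j) = 'X^(height b - j) - 'X^(height b - j - 1).
  move=> /andP[j0 jm]; have [jb jP] := strP j ltac:(by rewrite mE).
  by rewrite -hstr // IH // hstr //; lia.
(* By induction the left-hand side of [xi_rec] vanishes strictly inside the
   string. *)
have step j : (0 < j <= m)%N ->
    coef (xi' i) (str j) = coef (xi' i) (str j.+1).
  move=> jm; apply/eqP; rewrite -subr_eq0 strS.
  rewrite -xi_rec; last by rewrite stri; lia.
  have := height_eq0 (str m.+1); rewrite hstr // (negPf (P_neq0 smP)) => hm.
  rewrite -strS !coef_str; try lia.
  rewrite mulrBr -!exprS.
  have -> : (height b - j.+1).+1 = (height b - j)%N by lia.
  have -> : (height b - j.+1 - 1).+1 = (height b - j - 1)%N by lia.
  by rewrite subrr.
have tele k : (k <= m)%N -> coef (xi' i) (str 1%N) = coef (xi' i) (str k.+1).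
  by elim: k => // k IHk km; rewrite IHk 1?step //; lia.
(* The reflection exchanges the ends of the string, so xi' takes at [b] its
   constant value on the rest of the string. *)
have smE : reflect_expo i (C i) b = str m.+1.
  apply/ffunP => k; rewrite !ffunE mE; case: eqP => [->|_].
    by rewrite muln1; move: (b i) mb => d; clear; lia.
  by rewrite muln0 subn0.
have := refl0 b; have [-> _] := P_reflect bP bi; rewrite smE => db.
have := xi_rec (leq_ltn_trans (leq0n m) mb).
have /= -> : expo_sub b (unit_expo i) = str 1%N by rewrite strS str0.
rewrite (tele m) // -db subrr => /eqP; rewrite subr_eq0 => /eqP ->.
have := height_eq0 (str m.+1); rewrite hstr // (negPf (P_neq0 smP)) => hm.
rewrite coef_str // mulrBr -!exprS; congr ('X^_ - 'X^_); lia.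
Qed.

End RootCombinatorics.
(** * Lie brackets and the Killing form *)

Section LieBasics.
Variables (K : fieldType) (g : lieAlgType K).
Implicit Types (x y z h : g).

HB.instance Definition _ x :=
  GRing.isLinear.Build K g g *:%R (@lie K g x) (lie_linearr x).

Lemma lie0r x : lie x 0 = 0. Proof. exact: linear0. Qed.
Lemma lieDr x y z : lie x (y + z) = lie x y + lie x z.
Proof. exact: linearD. Qed.
Lemma lieNr x y : lie x (- y) = - lie x y. Proof. exact: linearN. Qed.
Lemma lieZr a x y : lie x (a *: y) = a *: lie x y. Proof. exact: linearZ. Qed.

Lemma lieDl x y z : lie (x + y) z = lie x z + lie y z.
Proof. by have := lie_linearl z 1 x y; rewrite !scale1r. Qed.

Lemma lieC x y : lie x y = - lie y x.
Proof.
apply/eqP; rewrite -addr_eq0; apply/eqP.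
by have := liexx (x + y); rewrite lieDl !lieDr !liexx addr0 add0r.
Qed.

Lemma lie0l x : lie 0 x = 0. Proof. by rewrite lieC lie0r oppr0. Qed.
Lemma lieZl a x y : lie (a *: x) y = a *: lie x y.
Proof. by rewrite lieC lieZr -scalerN -lieC. Qed.

Lemma lie_lie x y z : lie x (lie y z) = lie (lie x y) z + lie y (lie x z).
Proof.
have := lie_jacobi x y z; rewrite (lieC z x) lieNr (lieC z (lie x y)).
by move/eqP; rewrite -addrA -opprD subr_eq0 addrC => /eqP.
Qed.

Definition ad x : 'End(g) := linfun (@lie K g x).

Lemma adE x y : ad x y = lie x y. Proof. exact: lfunE. Qed.

Lemma ad_linear : linear ad.
Proof.
move=> a x y; apply/lfunP => z.
by rewrite add_lfunE scale_lfunE !adE lieDl lieZl.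
Qed.

HB.instance Definition _ := GRing.isLinear.Build K g 'End(g) *:%R
  ad ad_linear.

(** The center is the kernel of the adjoint map, an ideal; it is not everything
because the bracket is not zero. *)
Lemma lie_simple_center x : lie_simple g -> (forall y, lie x y = 0) -> x = 0.
Proof.
case=> [[u [v uv]] simple] xc.
pose Z := lker (linfun ad).
have inZ y : (y \in Z) = (ad y == 0) by rewrite memv_ker lfunE.
have ZP y : reflect (forall z, lie y z = 0) (y \in Z).
  rewrite inZ; apply: (iffP eqP) => [y0 z|y0].
    by have := congr1 (fun f : 'End(g) => f z) y0; rewrite adE zero_lfunE.
  by apply/lfunP => z; rewrite adE zero_lfunE y0.
have [|Z0|Z1] := simple Z.
- move=> y z /ZP z0; apply/ZP => t.
  by rewrite (lieC y z) z0 oppr0 lie0l.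
- have : x \in Z by apply/ZP.
  by rewrite Z0 memv0 => /eqP.
- have : u \in Z by rewrite Z1 memvf.
  by move/ZP => /(_ v) u0; rewrite u0 eqxx in uv.
Qed.

Definition killing x y : K := \tr (f2mx (ad x) *m f2mx (ad y)).

Lemma v2r_lie x y : v2r (lie x y) = v2r y *m f2mx (ad x).
Proof. by rewrite -adE /ad unlock /= r2vK. Qed.

Lemma f2mx_lie x y : f2mx (ad (lie x y)) =
  f2mx (ad y) *m f2mx (ad x) - f2mx (ad x) *m f2mx (ad y).
Proof.
apply/row_matrixP => i; rewrite !rowE mulmxBr !mulmxA.
rewrite -[delta_mx 0 i]r2vK -!v2r_lie -linearB; congr v2r.
by rewrite lie_lie addrK.
Qed.

Lemma f2mx_adZD a x y : f2mx (ad (a *: x + y)) =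
  a *: f2mx (ad x) + f2mx (ad y).
Proof.
apply/row_matrixP => i; rewrite !rowE mulmxDr -scalemxAr.
rewrite -[delta_mx 0 i]r2vK -!v2r_lie -linearZ -linearD; congr v2r.
by rewrite lieDl lieZl.
Qed.

Lemma killingC x y : killing x y = killing y x.
Proof. exact: mxtrace_mulC. Qed.

Lemma killing_lie x y z : killing (lie x y) z = killing x (lie y z).
Proof.
rewrite /killing !f2mx_lie mulmxBl mulmxBr !raddfB /=; congr (_ - _).
  by rewrite mxtrace_mulC mulmxA mxtrace_mulC mulmxA mxtrace_mulC mulmxA.
by rewrite mulmxA.
Qed.

Lemma killing_linear x : linear (killing x : g -> K^o).
Proof.
move=> a y z; rewrite /killing f2mx_adZD mulmxDr -scalemxAr.
by rewrite raddfD /= mxtraceZ.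
Qed.

HB.instance Definition _ x := GRing.isLinear.Build K g K^o *:%R
  (killing x : g -> K^o) (killing_linear x).

Lemma killing0l y : killing 0 y = 0.
Proof. by rewrite killingC; exact: (linear0 (killing y : g -> K^o)). Qed.

Definition killing_lfun x : 'Hom(g, K^o) := linfun (killing x : g -> K^o).

Lemma killing_lfunE x y : killing_lfun x y = killing x y.
Proof. exact: lfunE. Qed.

Lemma killingZr a x y : killing x (a *: y) = a * killing x y.
Proof. by rewrite -!killing_lfunE linearZ. Qed.

Lemma killing_sumr x I (r : seq I) (F : I -> g) :
  killing x (\sum_(i <- r) F i) = \sum_(i <- r) killing x (F i).
Proof.
rewrite -killing_lfunE linear_sum; apply: eq_bigr => i _.
exact: killing_lfunE.
Qed.

Lemma killing_lfun_linear : linear killing_lfun.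
Proof.
move=> a x y; apply/lfunP => z; rewrite /killing_lfun.
rewrite add_lfunE scale_lfunE !lfunE /= !(killingC _ z).
exact: killing_linear.
Qed.

HB.instance Definition _ := GRing.isLinear.Build K g 'Hom(g, K^o) *:%R
  killing_lfun killing_lfun_linear.

(** The radical of the Killing form is an ideal, by invariance. *)
Lemma killing_radical : lie_simple g ->
  (forall x y, killing x y = 0) \/
  (forall x, (forall y, killing x y = 0) -> x = 0).
Proof.
move=> [_ simple]; pose Z := lker (linfun killing_lfun).
have ZP y : reflect (forall z, killing y z = 0) (y \in Z).
  rewrite memv_ker lfunE /=; apply: (iffP eqP) => [y0 z|y0].
    by rewrite -killing_lfunE y0 zero_lfunE.
  by apply/lfunP => z; rewrite killing_lfunE zero_lfunE y0.
have [|Z0|Z1] := simple Z.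
- move=> y z /ZP z0; apply/ZP => t.
  by rewrite (lieC y z) -lieNr killing_lie z0.
- by right=> x /ZP; rewrite Z0 memv0 => /eqP.
- by left=> x y; apply: (ZP x); rewrite Z1 memvf.
Qed.

End LieBasics.

(** * Weight vectors of a Cartan subalgebra *)

Section Weights.
Variables (K : fieldType) (g : lieAlgType K) (H : {vspace g}).
Implicit Types (x y : g) (lam mu : dual H).

Lemma weight_vectorZ lam a x :
  weight_vector lam x -> weight_vector lam (a *: x).
Proof. by move=> lx h; rewrite lieZr lx !scalerA mulrC. Qed.

Lemma weight_vector_lie lam mu x y :
  weight_vector lam x -> weight_vector mu y ->
  weight_vector (lam + mu) (lie x y).
Proof.
move=> lx my h; rewrite lie_lie lx my lieZr lieZl -scalerDl.
by rewrite add_lfunE.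
Qed.

Definition weight_basis (X : (dim g).-tuple g) (w : 'I_(dim g) -> dual H) :=
  basis_of fullv X /\ forall j, weight_vector (w j) X`_j.

Lemma free_basis_full (X : (dim g).-tuple g) : free X -> basis_of fullv X.
Proof.
by move=> fX; rewrite basisEfree fX subvf dimvf size_tuple leqnn.
Qed.

Lemma free_unitmx (X : (dim g).-tuple g) : free X = (b2mx X \in unitmx).
Proof.
have spanE : span X = mx2vs (b2mx X).
  by rewrite unlock /span_expanded_def tvalK; case: _ / (esym _).
by rewrite -row_free_unit /free /dimv spanE genmxE size_tuple.
Qed.

Lemma ad_diagonalizable_mx (h : g) :
  ad_diagonalizable h -> diagonalizable (f2mx (ad h)).
Proof.
move=> [X bX eX].
have sX : size X == dim g.
  by rewrite -dimvf -(size_basis (X := in_tuple X) bX).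
pose T := Tuple sX; have fT : free T := basis_free bX.
have uT : b2mx T \in unitmx by rewrite -free_unitmx.
have /all_sig [c cE] : forall i : 'I_(dim g), {c | lie h T`_i = c *: T`_i}.
  move=> i; apply/cid/eX/mem_nth.
  by rewrite (eqP sX).
exists (b2mx T) => //; apply/diagonalizable_forPex; exists (\row_i c i).
apply/simmxP => //; apply/row_matrixP => i.
rewrite !row_mul row_diag_mx mxE -scalemxAl -rowE.
by rewrite rowK -v2r_lie (tnth_nth 0) cE linearZ.
Qed.

(** The adjoint action of a Cartan subalgebra consists of commuting
diagonalizable operators, so a single basis diagonalizes all of them. *)
Lemma weight_basis_exists : cartan_subalgebra H ->
  exists X w, weight_basis X w.
Proof.
case=> Hab _ Hdiag.
have : codiagonalizable [seq f2mx (ad h) | h <- vbasis H].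
  apply/codiagonalizableP; split=> [A B|A].
    move=> /mapP[h hH ->] /mapP[h' h'H ->]; rewrite /comm_mx.
    apply/eqP; rewrite -subr_eq0 -f2mx_lie Hab ?vbasis_mem //.
    apply/eqP/row_matrixP => i; rewrite row0 rowE.
    by rewrite -[delta_mx 0 i]r2vK -v2r_lie lie0l linear0.
  by move=> /mapP[h hH ->]; apply/ad_diagonalizable_mx/Hdiag/vbasis_mem.
case=> P uP /allP diagP.
pose X : (dim g).-tuple g := [tuple r2v (row i P) | i < dim g].
have XE (i : 'I_(dim g)) : X`_i = r2v (row i P).
  by rewrite -tnth_nth tnth_mktuple.
have fX : free X.
  rewrite free_unitmx; suff -> : b2mx X = P by [].
  by apply/row_matrixP => i; rewrite rowK tnth_mktuple r2vK.
(* The eigenvalue of [h] on [X`_j] is the j-th coordinate of [lie h X`_j], an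
   expression that is linear in [h]. *)
pose w j : dual H :=
  (linfun (coord X j : g -> K^o) \o - ad X`_j \o linfun vsval)%VF.
exists X, w; split; first exact: free_basis_full.
move=> j h; suff [c cE] : exists c, lie (vsval h) X`_j = c *: X`_j.
  rewrite !comp_lfunE opp_lfunE adE !lfunE /= -lieC cE linearZ /= coord_free //.
  rewrite eqxx. by congr (_ *: _); rewrite /GRing.scale /= mulr1.
have bas b : b \in vbasis H -> exists c, lie b X`_j = c *: X`_j.
  move=> bH; have /diagP/= /diagonalizable_forPex[D /(simmxP uP)] :
    f2mx (ad b) \in [seq f2mx (ad h) | h <- vbasis H] by exact: map_f.
  move=> /(congr1 (row j)); rewrite !row_mul row_diag_mx -scalemxAl -rowE => e.
  exists (D 0 j); apply: v2r_inj.
  by rewrite v2r_lie XE r2vK linearZ /= r2vK e.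
rewrite (coord_vbasis (subvsP h)).
elim/big_rec: _ => [|k y _ [c cE]]; first by exists 0; rewrite lie0l scale0r.
have [|d dE] := bas (vbasis H)`_k; first by apply: mem_nth; rewrite size_tuple.
rewrite lieDl lieZl dE cE scalerA -scalerDl.
by eexists.
Qed.

Section WithBasis.
Variables (X : (dim g).-tuple g) (w : 'I_(dim g) -> dual H).
Hypothesis Xw : weight_basis X w.

Let fX : free X. Proof. exact: basis_free (proj1 Xw). Qed.

Lemma weight_basis_sum x : x = \sum_i coord X i x *: X`_i.
Proof. exact: coord_basis (proj1 Xw) (memvf x). Qed.

Lemma weight_basis_neq0 (i : 'I_(dim g)) : X`_i != 0.
Proof.
by apply: (basis_not0 (proj1 Xw)); apply: mem_nth; rewrite size_tuple.
Qed.

Lemma coord_lie_weight h x i :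
  coord X i (lie (vsval h) x) = (w i h : K) * coord X i x.
Proof.
rewrite {1}(weight_basis_sum x) linear_sum /= (eq_bigr (fun j =>
  (coord X j x * w j h) *: X`_j)); last first.
  by move=> j _; rewrite lieZr (proj2 Xw) scalerA.
by rewrite coord_sum_free // mulrC.
Qed.

Lemma weight_coord lam x i :
  weight_vector lam x -> coord X i x != 0 -> lam = w i.
Proof.
move=> lx xi; apply/lfunP => h; apply: (mulIf xi).
by rewrite -coord_lie_weight lx linearZ.
Qed.

Lemma weight_in lam x : x != 0 -> weight_vector lam x -> exists i, lam = w i.
Proof.
move=> x0 lx; have [i xi|x00] := pickP (fun i => coord X i x != 0).
  by exists i; exact: weight_coord xi.
case/eqP: x0; rewrite (weight_basis_sum x) big1 // => i _.
by have /negbFE/eqP -> := x00 i; rewrite scale0r.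
Qed.

(** In a weight basis the adjoint matrices of the Cartan subalgebra are
diagonal. *)
Lemma killing_weight_sum (h h' : subvs_of H) :
  killing (vsval h) (vsval h') = \sum_i (w i h : K) * w i h'.
Proof.
have uP : b2mx X \in unitmx by rewrite -free_unitmx.
pose D (h : subvs_of H) : 'rV[K]_(dim g) := \row_i w i h.
have ME l : f2mx (ad (vsval l)) = invmx (b2mx X) *m diag_mx (D l) *m b2mx X.
  rewrite -mulmxA; apply: (canRL (mulKmx uP)).
  apply/row_matrixP => i; rewrite !row_mul row_diag_mx mxE -scalemxAl -rowE.
  by rewrite rowK -v2r_lie (tnth_nth 0) (proj2 Xw) linearZ.
rewrite /killing !ME !mulmxA mulmxK // mxtrace_mulC !mulmxA.
rewrite mulmxV // mul1mx mulmx_diag mxtrace_diag.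
by apply: eq_bigr => i _; rewrite !mxE.
Qed.

End WithBasis.
End Weights.

(** * Strings of weights *)

Lemma mulrn_lmod_inj (K : numFieldType) (V : lmodType K) (a : V) :
  a != 0 -> injective (GRing.natmul a).
Proof.
move=> a0 k l; rewrite -!scaler_nat => /eqP.
rewrite -subr_eq0 -scalerBl scaler_eq0 (negPf a0) orbF subr_eq0 eqr_nat.
by move/eqP.
Qed.

Section Strings.
Variables (K : numFieldType) (g : lieAlgType K) (H : {vspace g}).
Hypothesis Hc : cartan_subalgebra H.
Implicit Types (x y e f v : g) (al be : dual H) (h : subvs_of H).

Lemma dual_mulrn al k h : ((al *+ k) h : K) = k%:R * al h.
Proof. by rewrite -scaler_nat scale_lfunE. Qed.

Lemma weight0_in_cartan x : weight_vector (0 : dual H) x -> x \in H.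
Proof.
move=> x0; case: Hc => _ cent _; apply: cent => h hH.
by have := x0 (Subvs hH); rewrite zero_lfunE scale0r.
Qed.

Lemma weight_iter al be e v k : weight_vector al e -> weight_vector be v ->
  weight_vector (be + al *+ k) (iter k (lie e) v).
Proof.
move=> we wv; elim: k => [|k IH]; first by rewrite addr0.
by rewrite mulrS addrCA; apply: weight_vector_lie.
Qed.

(** The vectors [iter k (lie e) v] have distinct weights, and there are finitely
many weights. *)
Lemma lie_top al be e v : al != 0 -> v != 0 ->
  weight_vector al e -> weight_vector be v ->
  exists q, iter q (lie e) v != 0 /\ lie e (iter q (lie e) v) = 0.
Proof.
move=> al0 v0 we wv; have [X [w Xw]] := weight_basis_exists Hc.
have [[k kv]|no] := pselect (exists k, iter k (lie e) v == 0).
  have [[|m] /eqP mv mmin] :=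
    ex_minnP (ex_intro (fun k => iter k (lie e) v == 0) k kv).
    by rewrite -[v]/(iter 0 (lie e) v) mv eqxx in v0.
  exists m; split => //; apply/negP => /mmin; lia.
have nz k : iter k (lie e) v != 0 by apply/negP => k0; apply: no; exists k.
have /choice[F FP] k := weight_in Xw (nz k) (weight_iter k we wv).
have : injective (fun k : 'I_(dim g).+1 => F k).
  move=> k l /= kl; have := FP k; rewrite kl -FP => /addrI.
  by move/(mulrn_lmod_inj al0)/val_inj.
by move/leq_card; rewrite !card_ord ltnn.
Qed.

(** Representation theory of sl2 without normalizing [al h], which may even be
zero: [u] is a top vector of the string through [v], at [q] steps above it, and
lowering it [N] times stays nonzero.  The last identity is what the vanishing of
the vector after that forces. *)
Lemma root_string al be e f h v : al != 0 -> v != 0 ->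
  weight_vector al e -> weight_vector (- al) f -> lie e f = vsval h ->
  weight_vector be v ->
  exists q N u, [/\ weight_vector (be + al *+ q) u,
    forall j, (j <= N)%N -> iter j (lie f) u != 0,
    forall j, lie e (iter j.+1 (lie f) u) =
      (j.+1%:R * (N%:R - j%:R) * (al h / 2)) *: iter j (lie f) u
    & (be h : K) + q%:R * al h = N%:R * (al h / 2)].
Proof.
move=> al0 v0 we wf efh wv; have [q []] := lie_top al0 v0 we wv.
have := weight_iter q we wv; set u := iter q (lie e) v => wu u0 eu.
have wuj j : weight_vector (be + al *+ q - al *+ j) (iter j (lie f) u).
  by rewrite -mulNrn; exact: weight_iter.
have nal0 : - al != 0 by rewrite oppr_eq0.
have [N [uN0 uN1]] := lie_top nal0 u0 wf wu.
pose m : K := be h + q%:R * al h.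
(* The coefficient at j.+1 is that at [j] plus the value on [h] of the weight
   of the vector being lowered. *)
have calc j : lie e (iter j.+1 (lie f) u) =
    (j.+1%:R * (m - j%:R * (al h / 2))) *: iter j (lie f) u.
  elim: j => [|j IH].
    rewrite /= lie_lie eu lie0r addr0 efh wu add_lfunE dual_mulrn.
    by rewrite mul0r subr0 mul1r.
  rewrite [iter j.+2 _ _]iterS lie_lie IH efh wuj lieZr -scalerDl.
  congr (_ *: _); rewrite !add_lfunE opp_lfunE !dual_mulrn /m.
  by rewrite -!natr1; field.
have mN : m = N%:R * (al h / 2).
  have /eqP := calc N; rewrite iterS uN1 lie0r eq_sym scaler_eq0.
  by rewrite (negPf uN0) orbF mulf_eq0 pnatr_eq0 subr_eq0 => /eqP.
exists q, N, u; split=> // [j jN|j].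
  apply: contra_neq uN0 => uj0; rewrite -(subnK jN) iterD uj0.
  by elim: (N - j)%N => //= k ->; rewrite lie0r.
by rewrite calc mN -mulrBl mulrA.
Qed.

End Strings.

(** * Coroots in a simple Lie algebra *)

Section Simple.
Variables (K : numFieldType) (g : lieAlgType K) (H : {vspace g}).
Hypotheses (gs : lie_simple g) (Hc : cartan_subalgebra H).
Implicit Types (x y e f v : g) (al be : dual H) (h : subvs_of H).

(** Were [al h] zero, [root_string] would make every weight vanish on [h], so
that [h] would be central. *)
Lemma opposite_bracket_root_neq0 al e f h : al != 0 ->
  weight_vector al e -> weight_vector (- al) f -> lie e f = vsval h ->
  lie e f != 0 -> (al h : K) != 0.
Proof.
move=> al0 we wf efh; apply: contra_neq => alh0; rewrite efh.
apply: (lie_simple_center gs) => y.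
have [X [w Xw]] := weight_basis_exists Hc.
rewrite (weight_basis_sum Xw y) linear_sum big1 //= => i _; rewrite lieZr.
rewrite (proj2 Xw); have [q [N [u [_ _ _]]]] := 
  root_string Hc al0 (weight_basis_neq0 Xw i) we wf efh (proj2 Xw i).
by rewrite alh0 mul0r !mulr0 addr0 => ->; rewrite scale0r scaler0.
Qed.

Lemma killing_orthogonal al be x y : al + be != 0 ->
  weight_vector al x -> weight_vector be y -> killing x y = 0.
Proof.
move=> abn0 wx wy; apply: contra_neq_eq abn0 => k0; apply/lfunP => h.
rewrite zero_lfunE add_lfunE; apply: (mulIf k0); rewrite mul0r mulrDl.
have: killing (lie x (vsval h)) y = killing x (lie (vsval h) y).
  exact: killing_lie.
rewrite lieC wx wy -scaleNr killingC !killingZr killingC.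
by rewrite mulNr => <-; rewrite addrN.
Qed.

(** Invariance of the form, and the action of the Cartan subalgebra on [f]. *)
Lemma killing_bracket al e f h : weight_vector al e -> weight_vector (- al) f ->
  killing (lie e f) (vsval h) = al h * killing e f.
Proof.
move=> we wf; rewrite killing_lie lieC wf opp_lfunE -scaleNr opprK.
by rewrite killingZr.
Qed.

(** Otherwise no bracket has a component of weight zero.  If some basis vector
has weight zero, the kernel of its coordinate is then a proper ideal containing
all brackets, so it is zero by simplicity, and so are all brackets; if none has,
the Cartan subalgebra is zero, yet equal to its own centralizer, which is then
everything. *)
Lemma opposite_bracket_exists : exists al e f,
  [/\ weight_vector (al : dual H) e, weight_vector (- al) f & lie e f != 0].
Proof.
apply: contrapT => no.
have br0 al e f : weight_vector (al : dual H) e -> weight_vector (- al) f ->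
    lie e f = 0.
  by move=> we wf; apply/eqP/negPn/negP => ef; apply: no; exists al, e, f.
have [X [w Xw]] := weight_basis_exists Hc.
have [[i wi]|no0] := pselect (exists i, w i = 0).
  have ci x y : coord X i (lie x y) = 0.
    rewrite (weight_basis_sum Xw x) (weight_basis_sum Xw y) linear_sum.
    rewrite linear_sum big1 //= => j _; rewrite lieZr linearZ /= lieC.
    rewrite linear_sum linearN linear_sum big1 /= ?oppr0 ?mulr0 // => k _.
    rewrite lieZr linearZ /=; apply/eqP; rewrite mulf_eq0; apply/orP; right.
    have wjk := weight_vector_lie (proj2 Xw j) (proj2 Xw k).
    apply/negPn/negP => cjk.
    have := weight_coord Xw wjk cjk; rewrite wi => wjk0.
    case/negP: cjk; apply/eqP; rewrite (br0 (w j)) ?linear0 //.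
      exact: (proj2 Xw).
    suff -> : - w j = w k by exact: (proj2 Xw).
    by apply/eqP; rewrite eqr_oppLR -addr_eq0 wjk0.
  pose V := lker (linfun (coord X i : g -> K^o)).
  have VE x : (x \in V) = (coord X i x == 0) by rewrite memv_ker lfunE.
  case: gs => [[x [y xy]] simple].
  have [|V0|V1] := simple V; first by move=> *; rewrite VE ci.
    have : lie x y \in V by rewrite VE ci.
    by rewrite V0 memv0 (negPf xy).
  have : X`_i \in V by rewrite V1 memvf.
  by rewrite VE coord_free ?(basis_free (proj1 Xw)) // eqxx oner_eq0.
have H0 (x : g) : x \in H -> x = 0.
  move=> xH; rewrite (weight_basis_sum Xw x) big1 // => i _.
  have [->|ci] := eqVneq (coord X i x) 0; first by rewrite scale0r.
  case: no0; exists i; apply/esym/(weight_coord Xw _ ci) => h'.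
  rewrite zero_lfunE scale0r; case: Hc => ab _ _; apply: ab => //.
  exact: subvsP.
case: gs => [[x [y /eqP xy]] _]; case: xy; suff -> : x = 0 by rewrite lie0l.
by apply: (H0); case: Hc => _ cent _; apply: cent => h /H0 ->; rewrite lie0l.
Qed.

Lemma sl2_weight_int al e f h be v : al != 0 ->
  weight_vector al e -> weight_vector (- al) f -> lie e f = vsval h ->
  (al h : K) = 2 -> v != 0 -> weight_vector be v ->
  exists z : int, (be h : K) = z%:~R.
Proof.
move=> al0 we wf efh al2 v0 wv.
have [q [N [u [_ _ _]]]] := root_string Hc al0 v0 we wf efh wv.
rewrite al2 divff ?pnatr_eq0 // mulr1 => /(canRL (addrK _)) ->.
by exists (N%:Z - q%:Z * 2); rewrite rmorphB rmorphM.
Qed.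

Definition sl2_triple al e f h :=
  [/\ weight_vector al e, weight_vector (- al) f, lie e f = vsval h
    & (al h : K) = 2].

Lemma sl2_of_bracket al e f : al != 0 ->
  weight_vector al e -> weight_vector (- al) f -> lie e f != 0 ->
  exists e' h, sl2_triple al e' f h.
Proof.
move=> al0 we wf ef0.
have efH : lie e f \in H.
  apply: (weight0_in_cartan Hc); rewrite -(subrr al).
  exact: weight_vector_lie.
have efE : lie e f = vsval (Subvs efH) by [].
have alh := opposite_bracket_root_neq0 al0 we wf efE ef0.
set a : K := al _ in alh.
exists ((2 / a) *: e), ((2 / a) *: Subvs efH); split=> //.
- exact: weight_vectorZ.
- by rewrite lieZl.
- by rewrite linearZ /= /GRing.scale /= -/a divfK.
Qed.

Lemma sl2_neq0 al e f h : sl2_triple al e f h -> al != 0.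
Proof.
case=> _ _ _ al2; apply/eqP => al0; move/eqP: al2.
by rewrite al0 zero_lfunE eq_sym pnatr_eq0.
Qed.

(** The square is a sum of squares of integers, and the weight [al] contributes
a positive one. *)
Lemma sl2_killing al e f h : sl2_triple al e f h ->
  0 < killing (vsval h) (vsval h).
Proof.
move=> s; have al0 := sl2_neq0 s; case: s => we wf efh al2.
have [X [w Xw]] := weight_basis_exists Hc.
rewrite (killing_weight_sum Xw).
have ge0 i : 0 <= (w i h : K) * w i h.
  have [z ->] := sl2_weight_int al0 we wf efh al2
    (weight_basis_neq0 Xw i) (proj2 Xw i).
  by rewrite -rmorphM ler0z -expr2 sqr_ge0.
have e0 : e != 0.
  apply/eqP => e0; move: efh; rewrite e0 lie0l => h0.
  have h00 : h = 0 by apply: val_inj.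
  by move/eqP: al2; rewrite h00 linear0 eq_sym pnatr_eq0.
have [i ali] := weight_in Xw e0 we.
rewrite (bigD1 i) //= ltr_wpDr ?sumr_ge0 // -ali al2.
by rewrite mulr_gt0 // ltr0n.
Qed.

(** The form is not identically zero because it is positive on the coroot that
comes from some nonzero bracket. *)
Lemma killing_nondegenerate x : (forall y, killing x y = 0) -> x = 0.
Proof.
have [k0|] := killing_radical gs; last by apply.
have [al [e [f [we wf ef]]]] := opposite_bracket_exists.
have [al0|al0] := eqVneq al 0.
  case/eqP: ef; case: Hc => ab _ _; apply: ab; apply: (weight0_in_cartan Hc).
    by rewrite -al0.
  by rewrite -oppr0 -al0.
have [e' [h s]] := sl2_of_bracket al0 we wf ef.
by have := sl2_killing s; rewrite k0 ltxx.
Qed.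

(** A vector pairing nontrivially with a root vector for the Killing form may be
taken of opposite weight, and their bracket is then nonzero by
[killing_bracket]. *)
Lemma sl2_exists al : is_root al -> exists e f h, sl2_triple al e f h.
Proof.
case=> al0 [e e0 we].
have [f wf kef] : exists2 f, weight_vector (- al) f & killing e f != 0.
  apply: contrapT => no; case/eqP: e0; apply: killing_nondegenerate => y.
  have [X [w Xw]] := weight_basis_exists Hc.
  rewrite (weight_basis_sum Xw y) killing_sumr.
  rewrite big1 // => i _; rewrite killingZr.
  have [k0|ki] := eqVneq (killing e X`_i) 0; first by rewrite k0 mulr0.
  case: no; exists X`_i => //.
  suff -> : - al = w i by exact: (proj2 Xw).
  apply/eqP; rewrite eqr_oppLR -addr_eq0; apply: contraNT ki => awi.
  by apply/eqP/(killing_orthogonal awi we (proj2 Xw i)).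
have [|e' [h s]] := sl2_of_bracket al0 we wf; last by exists e', f, h.
have [h alh] : exists h, (al h : K) != 0.
  apply: contrapT => no; case/eqP: al0; apply/lfunP => h; rewrite zero_lfunE.
  by apply/eqP/negPn/negP => alh; apply: no; exists h.
apply/eqP => ef0; have := killing_bracket h we wf.
by rewrite ef0 killing0l => /esym/eqP; rewrite mulf_eq0 (negPf alh) (negPf kef).
Qed.

(** With [k] and [k'] the positive values of the Killing form on the pairs
[e, f] and [e', f'], symmetry on the coroots reads k (al h') = k' (be h). *)
Lemma sl2_pairing_sign al e f h be e' f' h' :
  sl2_triple al e f h -> sl2_triple be e' f' h' ->
  0 < (al h' : K) -> 0 < (be h : K).
Proof.
move=> s s'; have kh := sl2_killing s; have kh' := sl2_killing s'.
case: s s' => we wf efh al2 [we' wf' efh' be2].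
have key := killing_bracket h' we wf; have key' := killing_bracket h we' wf'.
have keyh := killing_bracket h we wf; have keyh' := killing_bracket h' we' wf'.
move: key key' keyh keyh'; rewrite efh efh' al2 be2 killingC => -> ke kk kk'.
move: kh kh'; rewrite kk kk' !pmulr_rgt0 ?ltr0n // => k0 k0' alp.
by rewrite -(pmulr_lgt0 _ k0') -ke pmulr_rgt0.
Qed.

(** The string through [al *+ k] passes through weight zero, that is through the
Cartan subalgebra, which two brackets with [e] annihilate.  But climbing two
steps along a string is nonzero as long as it starts at least two steps below
the top, which is the case when [1 < k]. *)
Lemma sl2_multiple al e f h k : sl2_triple al e f h ->
  is_root (al *+ k) -> (k <= 1)%N.
Proof.
move=> s; have al0 := sl2_neq0 s; case: s => we wf efh al2 [_ [v v0 wv]].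
rewrite leqNgt; apply/negP => k1.
have [q [N [u [wu unz eu]]]] := root_string Hc al0 v0 we wf efh wv.
rewrite dual_mulrn al2 divff ?pnatr_eq0 // mulr1 -mulrDl -natrD -natrM => /eqP.
rewrite eqr_nat => /eqP NE.
have wj := weight_iter (k + q) wf wu.
have uH : iter (k + q) (lie f) u \in H.
  apply: (weight0_in_cartan Hc); move: wj.
  by rewrite -mulrnDr mulNrn subrr.
have ee0 : lie e (lie e (iter (k + q) (lie f) u)) = 0.
  rewrite [lie e (iter _ _ _)]lieC (we (Subvs uH)).
  by rewrite lieNr lieZr liexx scaler0 oppr0.
move: ee0; have -> : (k + q = (k + q - 2).+2)%N by lia.
rewrite eu lieZr eu scalerA => /eqP; rewrite al2 divff ?pnatr_eq0 // !mulr1.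
rewrite scaler_eq0 (negPf (unz _ _)); last lia.
rewrite orbF !mulf_eq0 !pnatr_eq0 !subr_eq0 !eqr_nat; lia.
Qed.

Lemma sl2_opp al e f h : sl2_triple al e f h -> sl2_triple (- al) f e (- h).
Proof.
case=> we wf efh al2; split=> //; first by rewrite opprK.
  by rewrite lieC efh linearN.
by rewrite opp_lfunE linearN opprK.
Qed.

Lemma sl2_half_string al e f h be : sl2_triple al e f h -> is_root be ->
  exists m : int, (be h : K) = m%:~R /\
    forall j : nat, j%:Z <= m ->
      exists2 v, v != 0 & weight_vector (be - al *+ j) v.
Proof.
move=> s; have al0 := sl2_neq0 s; case: s => we wf efh al2 [_ [v v0 wv]].
have [q [N [u [wu unz _]]]] := root_string Hc al0 v0 we wf efh wv.
rewrite al2 divff ?pnatr_eq0 // mulr1 => /(canRL (addrK _)) bh.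
exists (N%:Z - q%:Z * 2); split; first by rewrite bh rmorphB rmorphM.
move=> j jm; exists (iter (q + j) (lie f) u); first by apply: unz; lia.
have := weight_iter (q + j) wf wu.
by rewrite mulNrn mulrnDr opprD addrA addrK.
Qed.

(** For negative [m], exchange the roles of [e] and [f]. *)
Lemma sl2_string al e f h be : sl2_triple al e f h -> is_root be ->
  exists m : int, [/\ (be h : K) = m%:~R,
    forall j : nat, j%:Z <= m ->
      exists2 v, v != 0 & weight_vector (be - al *+ j) v
  & forall j : nat, j%:Z <= - m ->
      exists2 v, v != 0 & weight_vector (be + al *+ j) v].
Proof.
move=> s rb; have [m [bm pos]] := sl2_half_string s rb.
have [m' [bm' neg]] := sl2_half_string (sl2_opp s) rb.
exists m; split=> // j jm.
have mm' : m' = - m.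
  by apply: (intr_inj (R := K)); rewrite -bm' linearN rmorphN /= bm.
by rewrite -[al *+ j]opprK -mulNrn; apply: neg; rewrite mm'.
Qed.

End Simple.

(** * Coordinates in the simple roots *)

Section RootLattice.
Variables (K : numFieldType) (g : lieAlgType K) (H : {vspace g}).
Hypotheses (gs : lie_simple g) (Hc : cartan_subalgebra H).
Variables (n : nat) (alpha : 'I_n -> dual H).
Hypothesis alphaP : simple_roots alpha.
Implicit Types (b : {ffun 'I_n -> nat}) (z : 'I_n -> int).

Definition root_lattice z : dual H := \sum_i alpha i *~ z i.

Lemma root_lattice_inj z z' : root_lattice z = root_lattice z' -> z =1 z'.
Proof.
move=> zz' i; have [/basis_free fA _ _] := alphaP.
pose T := [tuple alpha i | i < n]; have fT : free T by exact: fA.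
have coordT y j : coord T j (root_lattice y) = (y j)%:~R.
  rewrite -(coord_sum_free (fun k => (y k)%:~R) j fT); congr coord.
  by apply: eq_bigr => k _; rewrite -tnth_nth tnth_mktuple scaler_int.
by apply: (intr_inj (R := K)); rewrite -!coordT zz'.
Qed.

Lemma QplusE b : Qplus alpha b = root_lattice (fun i => (b i)%:Z).
Proof. by []. Qed.

Lemma Qplus_inj : injective (Qplus alpha).
Proof.
move=> b b'; rewrite !QplusE => /root_lattice_inj e.
by apply/ffunP => i; have [] := e i.
Qed.

Lemma Qplus_unit i : Qplus alpha (unit_expo i) = alpha i.
Proof.
rewrite /Qplus (bigD1 i) //= ffunE eqxx big1 ?addr0 // => j /negPf ji.
by rewrite ffunE ji.
Qed.

Lemma Qplus0 : Qplus alpha 0 = 0.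
Proof. by apply: big1 => i _; rewrite ffunE. Qed.

Lemma pos_roots_finite : finite_set (pos_roots alpha).
Proof.
have [X [w Xw]] := weight_basis_exists Hc.
apply: (@sub_finite_set _ _ (Qplus alpha @^-1` [set` codom w])%classic).
  move=> b [_ [x x0 wx]] /=; have [i ->] := weight_in Xw x0 wx.
  exact: codom_f.
apply: finite_preimage; last exact: finite_seq.
by move=> b b' _ _; exact: Qplus_inj.
Qed.

(** A positive root other than alpha_i has a positive coordinate off [i], since
no multiple of alpha_i besides alpha_i itself is a positive root.  A shift along
alpha_i keeps that coordinate, so a weight reached in this way is nonzero and
not a negative root. *)
Lemma pos_root_shift i e f h b (z : int) v : sl2_triple (alpha i) e f h ->
  pos_roots alpha b -> b != unit_expo i -> v != 0 ->
  weight_vector (Qplus alpha b - alpha i *~ z) v ->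
  z <= (b i)%:Z /\
  pos_roots alpha [ffun k => if k == i then `|(b i)%:Z - z|%N else b k].
Proof.
move=> s rb bi v0 wv.
have [k /andP[ki bk]] : exists k, (k != i) && (b k != 0%N).
  apply: contrapT => no; have bE k : k != i -> b k = 0%N.
    by move=> ki; apply/eqP/negPn/negP => bk; apply: no; exists k; rewrite ki.
  have Qb : Qplus alpha b = alpha i *+ b i.
    by rewrite /Qplus (bigD1 i) //= big1 ?addr0 // => k /bE ->.
  have bi1 : (b i <= 1)%N.
    by apply: (sl2_multiple Hc s); rewrite -Qb.
  have bi0 : (0 < b i)%N.
    by rewrite lt0n; apply/eqP => bi0; case: rb => /eqP[]; rewrite Qb bi0.
  case/eqP: bi; apply/ffunP => k; rewrite ffunE.
  by case: eqP => [->|/eqP/bE ->] //; apply/eqP; rewrite eqn_leq bi1.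
pose y k := if k == i then (b k)%:Z - z else (b k)%:Z.
have lamE : Qplus alpha b - alpha i *~ z = root_lattice y.
  rewrite QplusE /root_lattice (bigD1 i) //= [RHS](bigD1 i) //=.
  rewrite /y eqxx mulrzBr addrAC; congr (_ + _).
  by apply: eq_bigr => j /negPf ->.
have r0 : is_root (root_lattice y).
  rewrite -lamE; split; last by exists v.
  rewrite lamE; apply/eqP => y0; have : root_lattice y = root_lattice (fun=> 0).
    by rewrite y0 /root_lattice big1.
  move/root_lattice_inj/(_ k); rewrite /y (negPf ki) => -[] /eqP.
  by rewrite (negPf bk).
have [_ _ /(_ _ r0)[b' [yb|yb]]] := alphaP; last first.
  have : root_lattice y = root_lattice (fun i => - (b' i)%:Z).
    by rewrite yb /root_lattice -sumrN; apply: eq_bigr => j _; rewrite mulrNz.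
  by move/root_lattice_inj/(_ k); rewrite /y (negPf ki); lia.
have yE := root_lattice_inj (etrans yb (QplusE b')).
have /= zi := yE i; rewrite /y eqxx in zi.
split; first by rewrite -subr_ge0 zi.
suff -> : [ffun k => if k == i then `|(b i)%:Z - z|%N else b k] = b'.
  by rewrite /pos_roots /= -yb.
apply/ffunP => j; rewrite ffunE; have /= := yE j; rewrite /y.
by case: eqP => [->|_]; [rewrite zi | case].
Qed.

Lemma coef_xi b : pos_roots alpha b ->
  coef (xi alpha) b = 'X^(height b) - 'X^(height b - 1).
Proof.
move=> rb; have /finite_seqP[s sE] := pos_roots_finite.
have inP b' : (b' \in undup s) <-> pos_roots alpha b'.
  by rewrite mem_undup sE.
have xiE : xi alpha = \prod_(a <- undup s) xi_factor a.
  rewrite /xi (_ : pos_roots alpha = [set` undup s]%classic).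
    by rewrite -fsbig_seq ?undup_uniq.
  by apply/seteqP; split=> a /inP.
have [_ rootA _] := alphaP.
have /choice[h hP] i :
    exists h, exists ef : g * g, sl2_triple (alpha i) ef.1 ef.2 h.
  by have [e [f [h s']]] := sl2_exists gs Hc (rootA i); exists h, (e, f).
have int_root i lam : is_root lam -> exists m : int, (lam (h i) : K) = m%:~R.
  have [ef s'] := hP i => /(sl2_string Hc s')[m [mE _ _]].
  by exists m.
have /choice[C CE] i : exists c : 'I_n -> int, forall j,
    (alpha j (h i) : K) = (c j)%:~R.
  by have /choice[c cE] j := int_root i _ (rootA j); exists c.
have pairE i b' : (Qplus alpha b' (h i) : K) = (pairing (C i) b')%:~R.
  rewrite /Qplus sum_lfunE rmorph_sum; apply: eq_bigr => j _.
  by rewrite dual_mulrn CE rmorphMn /= mulr_natl.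
(* The second alternative adds the reflection when the pairing is negative. *)
have strP i a : a \in undup s -> a != unit_expo i -> forall z : int,
    (0 <= z <= pairing (C i) a) \/ z = pairing (C i) a ->
    z <= (a i)%:Z /\
    [ffun k => if k == i then `|(a i)%:Z - z|%N else a k] \in undup s.
  move=> /inP ra ai z zP; have [ef s'] := hP i.
  have [m [mE pos neg]] := sl2_string Hc s' ra.
  have {}mE : pairing (C i) a = m.
    by apply: (intr_inj (R := K)); rewrite -pairE mE.
  have [v v0 wv] : exists2 v, v != 0 &
      weight_vector (Qplus alpha a - alpha i *~ z) v.
    rewrite mE in zP; case: z zP => k zP.
      by apply: pos; lia.
    by rewrite NegzE mulrNz opprK; apply: neg; lia.
  by have [? /inP] := pos_root_shift s' ra ai v0 wv.
rewrite xiE; apply: (@coef_prod_xi_factor n C); rewrite ?undup_uniq //.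
- move=> i; apply: (intr_inj (R := K)); rewrite -CE.
  by have [ef []] := hP i.
- by move=> i; apply/inP; rewrite /pos_roots /= Qplus_unit.
- by move=> a /inP[Qa _]; apply: contraNneq Qa => ->; rewrite Qplus0.
- by move=> i a aP ai; apply: (strP i a aP ai (pairing (C i) a)); right.
- move=> i a aP ai j ja; have [] := strP i a aP ai j%:Z; first by left; lia.
  move=> ji jP; split; first lia.
  suff -> : expo_sub a [ffun k => (j * (k == i))%N] =
    [ffun k => if k == i then `|(a i)%:Z - j%:Z|%N else a k] by [].
  apply/ffunP => k; rewrite !ffunE.
  by case: eqP => [->|_]; rewrite ?muln1 ?muln0 ?subn0 // distnEl.
(* If no simple coroot is positive on [a], then no simple root is positive on
   the coroot of [a], and neither is their nonnegative combination [a]. *)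
- move=> a /inP ra; have [e [f [ha s']]] := sl2_exists gs Hc ra.
  apply: contrapT => no.
  have le0 j : (alpha j ha : K) <= 0.
    have [m [mE _ _]] := sl2_string Hc s' (rootA j).
    rewrite mE -[0]/(0%:~R) ler_int leNgt -(ltr_int K) -mE; apply/negP => jp.
    have [ef sj] := hP j; have := sl2_pairing_sign Hc sj s' jp.
    by rewrite pairE ltr0z => jpos; apply: no; exists j.
  case: s' => _ _ _ /eqP; apply/negP; rewrite lt_eqF //.
  apply: le_lt_trans (_ : 0 < 2); last by rewrite ltr0n.
  rewrite /Qplus sum_lfunE sumr_le0 // => j _; rewrite dual_mulrn.
  by rewrite mulr_ge0_le0.
by apply/inP.
Qed.

End RootLattice.

Theorem proposition1 (R : realType) (g : lieAlgType R[i]) (H : {vspace g})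
    (n : nat) (alpha : 'I_n -> dual H) :
  lie_simple g ->
  cartan_subalgebra H ->
  \dim H = n ->
  simple_roots alpha ->
  forall b : {ffun 'I_n -> nat}, pos_roots alpha b ->
    coef (xi alpha) b = 'X^(height b) - 'X^(height b - 1).
Proof. by move=> gs Hc _ alphaP b; apply: coef_xi. Qed.
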